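(* For every integer $n\geq 8$, we have $D(n,K^\circlearrowright_3)=2^{\lfloor n^2/4\rfloor}$. Furthermore, among all graphs $G$ with $n$ vertices ($n\ge 8$), $D(G,K^\circlearrowright_3)=2^{\lfloor n^2/4\rfloor}$ if and only if $G\simeq K_{\lfloor n/2\rfloor,\lceil n/2\rceil}$.
   Context: All graphs are finite and simple. An orientation of a graph $G$ assigns a direction to each edge. $K^\circlearrowright_3$ denotes the directed (cyclically oriented, strongly connected) triangle. For a graph $G$, $D(G,K^\circlearrowright_3)$ is the number of orientations of $G$ containing no copy of $K^\circlearrowright_3$ (equivalently, in which every triangle of $G$ is transitively oriented). $D(n,K^\circlearrowright_3)=\max\{D(G,K^\circlearrowright_3)\colon G \text{ an $n$-vertex graph}\}$. *)

(* Defs.v *)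
From HB Require Import structures.
From mathcomp Require Import all_boot.

Set Implicit Arguments.
Unset Strict Implicit.
Unset Printing Implicit Defensive.

(* An edge {x, y} is represented by the two pairs (x, y) and (y, x). *)
Definition simple_adj (T : finType) (E : {set T * T}) : bool :=
  [forall x, (x, x) \notin E] &&
  [forall x, forall y, ((x, y) \in E) ==> ((y, x) \in E)].

Record sgraph (T : finType) : Type := SGraph {
  adj_set :> {set T * T};
  adj_setP : simple_adj adj_set
}.

HB.instance Definition _ (T : finType) := [isSub for @adj_set T].
HB.instance Definition _ (T : finType) := [Countable of sgraph T by <:].
HB.instance Definition _ (T : finType) := [Finite of sgraph T by <:].

Definition adj (T : finType) (G : sgraph T) : rel T :=
  fun x y => (x, y) \in adj_set G.

Definition digraph (T : finType) : Type := {set T * T}.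

Definition is_orientation (T : finType) (G : sgraph T) (A : digraph T) : bool :=
  [forall x, forall y,
    if adj G x y then ((x, y) \in A) (+) ((y, x) \in A) else (x, y) \notin A].

(* Copies are subgraphs, not necessarily induced. *)
Definition contains_copy (T S : finType) (A : digraph T) (H : digraph S) : bool :=
  [exists f : {ffun S -> T}, injectiveb f &&
    [forall x, forall y, ((x, y) \in H) ==> ((f x, f y) \in A)]].

Definition num_orient (T S : finType) (G : sgraph T) (H : digraph S) : nat :=
  #|[set A : {set T * T} | is_orientation G A && ~~ contains_copy A H]|.

Definition max_orient (S : finType) (n : nat) (H : digraph S) : nat :=
  \max_(G : sgraph 'I_n) num_orient G H.

Definition C3 : digraph 'I_3 := [set a : 'I_3 * 'I_3 | a.2 == ordS a.1].

Definition sgraph_iso (T U : finType) (G : sgraph T) (H : sgraph U) : Prop :=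
  exists2 f : T -> U, bijective f & forall x y, adj H (f x) (f y) = adj G x y.

Definition Kbip_set (a b : nat) : {set ('I_a + 'I_b) * ('I_a + 'I_b)} :=
  [set u | is_inl u.1 != is_inl u.2].

Lemma Kbip_simple (a b : nat) : simple_adj (Kbip_set a b).
Proof.
apply/andP; split; first by apply/forallP => x; rewrite inE /= eqxx.
apply/forallP => x; apply/forallP => y; apply/implyP.
by rewrite !inE /= eq_sym.
Qed.

Definition Kbip (a b : nat) : sgraph ('I_a + 'I_b)%type := SGraph (Kbip_simple a b).

(* Main.v *)
(** Deleting a vertex v of a graph G leaves at most D(G - v) orientations, and
    such an orientation extends to v by choosing an out-neighbourhood that is
    closed under arcs inside N(v); the number of choices is at most the number
    of stable subsets of N(v). If v has minimum degree d, then N(v) induces a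
    graph of minimum degree at least 2d - n, which bounds its stable subsets by
    2 ^ floor(n / 2), exactly the ratio of consecutive extremal values. The only
    exception for large n is n = 2k + 1 with N(v) a star on k + 1 vertices, where
    two deletions suffice. For n <= 7 the same recursion gives bounds close to
    n!, and its slack pays for the step to n = 8. *)

Require Import Defs.
From mathcomp Require Import all_boot zify.

Set Implicit Arguments.
Unset Strict Implicit.
Unset Printing Implicit Defensive.

Section TriangleFree.

Variables (T : finType) (e : rel T).
Hypotheses (e_sym : symmetric e) (e_irr : irreflexive e).

Implicit Types (S N X : {set T}) (A B : {set T * T}) (v w x y : T).

(** * Neighbourhoods, stable sets and transitive orientations *)

Definition nbh S v := [set u in S | e v u].

Definition stable S := [forall x in S, forall y in S, ~~ e x y].

Definition complete S := [forall x in S, forall y in S, (x != y) ==> e x y].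

Definition num_stable N := #|[set X : {set T} | X \subset N & stable X]|.

(** [A] orients the subgraph induced on [S], yet lives on all of [T] with no arc outside [S]:
    deleting a vertex changes [S] and never the type. *)
Definition transitive_on S A :=
  [forall x, forall y,
    if [&& x \in S, y \in S & e x y]
    then ((x, y) \in A) (+) ((y, x) \in A) else (x, y) \notin A] &&
  [forall x, forall y, forall z,
    ~~ [&& (x, y) \in A, (y, z) \in A & (z, x) \in A]].

Definition num_trans S := #|[set A | transitive_on S A]|.

(** The candidate out-neighbourhoods of a vertex joined to all of [N]: an arc from [X] to [N :\: X]
    would close a directed triangle through that vertex. *)
Definition upclosed A N :=
  [set X : {set T} | X \subset N &
    [forall x in X, forall y in N :\: X, (x, y) \notin A]].

Definition mindeg q N := forall w, w \in N -> q <= #|nbh N w|.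

Lemma upclosedP A N X :
  reflect (X \subset N /\
           forall x y, x \in X -> y \in N -> y \notin X -> (x, y) \notin A)
          (X \in upclosed A N).
Proof.
rewrite inE; apply: (iffP andP) => -[sXN H]; split=> //.
  move=> x y xX yN yX; move/forall_inP: H => /(_ x xX)/forall_inP; apply.
  by rewrite inE yX.
apply/forall_inP => x xX; apply/forall_inP => y; rewrite inE => /andP[yX yN].
exact: H.
Qed.

Lemma stableP S :
  reflect (forall x y, x \in S -> y \in S -> ~~ e x y) (stable S).
Proof.
apply: (iffP forall_inP) => H x; first by move=> y xS yS; apply: (forall_inP (H x xS)).
by move=> xS; apply/forall_inP => y yS; apply: H.
Qed.

Lemma stablePn S :
  reflect (exists x y, [/\ x \in S, y \in S & e x y]) (~~ stable S).
Proof.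
apply: (iffP idP) => [|[x [y [xS yS exy]]]].
  rewrite negb_forall_in => /exists_inP[x xS]; rewrite negb_forall_in.
  by case/exists_inP=> y yS /negPn exy; exists x, y.
by apply/stableP => /(_ x y xS yS); rewrite exy.
Qed.

Lemma completeP S :
  reflect (forall x y, x \in S -> y \in S -> x != y -> e x y) (complete S).
Proof.
apply: (iffP forall_inP) => H x.
  by move=> y xS yS; apply/implyP; apply: (forall_inP (H x xS)).
by move=> xS; apply/forall_inP => y yS; apply/implyP; apply: H.
Qed.

Lemma completePn S :
  reflect (exists x y, [/\ x \in S, y \in S, x != y & ~~ e x y]) (~~ complete S).
Proof.
apply: (iffP idP) => [|[x [y [xS yS nxy exy]]]].
  rewrite negb_forall_in => /exists_inP[x xS]; rewrite negb_forall_in.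
  by case/exists_inP=> y yS; rewrite negb_imply => /andP[]; exists x, y.
by apply/completeP => /(_ x y xS yS nxy); apply/negP.
Qed.

Lemma sub_stable S N : S \subset N -> stable N -> stable S.
Proof.
move=> /subsetP sSN /stableP st; apply/stableP => x y /sSN xN /sSN; exact: st.
Qed.

Lemma sub_complete S N : S \subset N -> complete N -> complete S.
Proof.
move=> /subsetP sSN /completeP st; apply/completeP => x y /sSN xN /sSN; exact: st.
Qed.

Lemma in_nbh S v u : (u \in nbh S v) = (u \in S) && e v u.
Proof. by rewrite inE. Qed.

Lemma nbh_sub S v : nbh S v \subset S.
Proof. by apply/subsetP => u; rewrite in_nbh => /andP[]. Qed.

Lemma notin_nbh S v : v \notin nbh S v.
Proof. by rewrite in_nbh e_irr andbF. Qed.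

Lemma nbh_subD1 S v : nbh S v \subset S :\ v.
Proof. by rewrite subsetD1 nbh_sub notin_nbh. Qed.

Lemma cardsD1E S v : v \in S -> #|S| = #|S :\ v|.+1.
Proof. by move=> vS; rewrite (cardsD1 v S) vS. Qed.

Lemma card_nbhD1 S v w : #|nbh S w| <= (v \in nbh S w) + #|nbh (S :\ v) w|.
Proof.
rewrite (cardsD1 v (nbh S w)) leq_add2l subset_leq_card //.
by apply/subsetP => u; rewrite !inE => /and3P[-> -> ->].
Qed.

Lemma nbhD1_nonadj S v w : ~~ e w v -> nbh (S :\ v) w = nbh S w.
Proof.
move=> nwv; apply/setP => u; rewrite !inE; case: eqVneq => //= ->.
by rewrite (negPf nwv) andbF.
Qed.

Lemma mindeg_D1 q N v : mindeg q.+1 N -> mindeg q (N :\ v).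
Proof.
move=> md w; rewrite inE => /andP[_ wN].
have := leq_trans (md w wN) (card_nbhD1 N v w); case: (v \in _) => /=; lia.
Qed.

(* In an orientation with only transitive triangles, the out-neighbourhood of
   a vertex is closed under arcs inside its neighbourhood, and it determines
   all the arcs at that vertex. *)
Lemma num_trans_del S v : v \in S ->
  num_trans S <=
  \sum_(B | transitive_on (S :\ v) B) #|upclosed B (nbh S v)|.
Proof.
move=> vS.
pose res A : {set T * T} := [set a in A | (a.1 != v) && (a.2 != v)].
have resP A : transitive_on S A -> transitive_on (S :\ v) (res A).
  case/andP=> /forallP oA /forallP tA; apply/andP; split.
    apply/forallP => x; apply/forallP => y; have := forallP (oA x) y.
    by rewrite !inE /=; case: (x == v); case: (y == v); rewrite ?andbF ?andbT.
  apply/forallP => x; apply/forallP => y; apply/forallP => z.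
  have := forallP (forallP (tA x) y) z; apply: contra; rewrite !inE.
  by case/and3P=> /andP[-> _] /andP[-> _] /andP[-> _].
rewrite /num_trans -sum1dep_card (partition_big res (transitive_on (S :\ v))) //=.
apply: leq_sum => B tB; rewrite sum1dep_card.
pose out A := [set y | (v, y) \in A].
rewrite -(card_in_imset (f := out)); last first.
  move=> A1 A2; rewrite !inE => /andP[/andP[/forallP o1 _] /eqP r1].
  case/andP=> /andP[/forallP o2 _] /eqP r2 /setP eo.
  have eov y : ((v, y) \in A1) = ((v, y) \in A2) by have := eo y; rewrite !inE.
  have eiv y : ((y, v) \in A1) = ((y, v) \in A2).
    have := forallP (o1 y) v; have := forallP (o2 y) v; rewrite !eov.
    by case: ifP => _; case: (_ \in A1); case: (_ \in A2); case: (_ \in A2).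
  apply/setP => -[x y]; case: (eqVneq x v) => [->//|nx].
  case: (eqVneq y v) => [->//|ny].
  move/setP: (etrans r1 (esym r2)) => /(_ (x, y)).
  by rewrite !inE /= nx ny !andbT.
apply/subset_leq_card/subsetP => X /imsetP[A]; rewrite inE.
case/andP=> /andP[/forallP oA /forallP tA] /eqP rA ->.
apply/upclosedP; split.
  apply/subsetP => y; rewrite !inE => vy; have := forallP (oA v) y.
  by rewrite vy vS /=; case: ifP.
move=> x y; rewrite !inE => vx /andP[yS evy] vy; rewrite -rA inE /=.
apply/negP => /andP[xy _].
have := forallP (forallP (tA v) x) y; rewrite vx xy /=.
have := forallP (oA v) y; rewrite vS yS evy (negPf vy) /= => -> //.
Qed.

(** * Closed out-neighbourhoods compared with stable sets *)

Lemma upclosed0 A N : N = set0 -> #|upclosed A N| <= 1.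
Proof.
move=> ->; rewrite -(cards1 (set0 : {set T})); apply: subset_leq_card.
by apply/subsetP => X /upclosedP[]; rewrite subset0 => /eqP-> _; rewrite inE.
Qed.

Lemma card_family_rec (F : {set {set T}}) w :
  #|F| = #|[set X in F | w \notin X]|
       + #|[set X : {set T} | (w \notin X) && (w |: X \in F)]|.
Proof.
rewrite -(cardsID [set X : {set T} | w \in X] F) addnC; congr (_ + _).
  by apply: eq_card => X; rewrite !inE andbC.
rewrite -(card_in_imset (f := fun X => X :\ w)); last first.
  move=> X Y; rewrite !inE => /andP[_ wX] /andP[_ wY] eXY.
  by rewrite -(setD1K wX) -(setD1K wY) eXY.
apply: eq_card => X; apply/imsetP/idP.
  case=> Y /setIP[uY wY] ->; rewrite inE in wY.
  by rewrite inE setD11 setD1K.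
rewrite inE => /andP[wX uX]; exists (w |: X); last by rewrite setU1K.
by rewrite !inE uX eqxx.
Qed.

(** Let [P] collect the closed sets avoiding [w], and [Q] those containing [w], with [w] removed.
    Members of [P :|: Q] are closed in [N :\ w]; a member of [P :&: Q] has a prescribed trace on the
    neighbourhood of [w], so the rest of it determines it. *)
Lemma upclosed_rec A N w : w \in N ->
  (forall x, x \in N -> e w x -> (w, x) \notin A -> (x, w) \in A) ->
  #|upclosed A N| <=
  #|upclosed A (N :\ w)| + #|upclosed A (N :\ w :\: nbh N w)|.
Proof.
move=> wN oA.
pose P := [set X in upclosed A N | w \notin X].
pose Q := [set X : {set T} | (w \notin X) && (w |: X \in upclosed A N)].
have inP X : (X \in P) = (X \in upclosed A N) && (w \notin X) by rewrite inE.
have inQ X : (X \in Q) = (w \notin X) && (w |: X \in upclosed A N) by rewrite inE.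
have -> : #|upclosed A N| = #|P| + #|Q| by apply: card_family_rec.
rewrite -cardsUI; apply: leq_add.
  apply/subset_leq_card/subsetP => X; rewrite in_setU inP inQ => /orP[/andP[/upclosedP[sX uX] wX]|].
    apply/upclosedP; rewrite subsetD1 sX wX; split=> // x y xX.
    by rewrite inE => /andP[_ yN]; apply: uX.
  case/andP=> wX /upclosedP[sX uX]; apply/upclosedP.
  rewrite subsetD1 wX (subset_trans (subsetUr _ _) sX); split=> // x y xX.
  move=> /setD1P[ynw yN] yX; apply: uX => //; rewrite !inE ?xX ?orbT //.
  by rewrite negb_or ynw.
(* As [X] is closed and misses [w], no arc goes from [X] to [w]; as [w |: X] is closed, every
   out-neighbour of [w] lies in [X]. *)
have nbhE X : X \in P :&: Q -> X :&: nbh N w = [set y in nbh N w | (w, y) \in A].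
  rewrite in_setI inP inQ.
  case/andP=> /andP[/upclosedP[sX uX] wX] /andP[_ /upclosedP[sX' uX']].
  apply/setP => y; rewrite !inE andbC; case: (boolP (y \in N)) => //= yN.
  case: (boolP (e w y)) => //= ewy; apply/idP/idP => [yX|].
    apply/negPn/negP => /(oA y yN ewy); apply/negP; exact: uX.
  apply: contraTT => yX; apply: uX' => //; first by rewrite !inE eqxx.
  rewrite !inE negb_or yX andbT; apply: contraTneq ewy => ->.
  by rewrite e_irr.
rewrite -(card_in_imset (f := fun X => X :\: nbh N w)); last first.
  move=> X Y XPQ YPQ eXY.
  by rewrite -(setID X (nbh N w)) eXY (nbhE X) // -(nbhE Y) // setID.
apply/subset_leq_card/subsetP => _ /imsetP[X XPQ ->].
have := XPQ; rewrite in_setI inP => /andP[/andP[/upclosedP[sX uX] wX] _].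
apply/upclosedP; split.
  by apply: setSD; rewrite subsetD1 sX.
move=> x y /setDP[xX xn] /setDP[/setD1P[ynw yN] yn] yX.
by apply: uX => //; apply: contra yX => yX; rewrite inE yn.
Qed.

Lemma num_stable_rec N w : w \in N ->
  num_stable N = num_stable (N :\ w) + num_stable (N :\ w :\: nbh N w).
Proof.
move=> wN; rewrite /num_stable.
rewrite (card_family_rec _ w); congr (_ + _); apply: eq_card => X.
  by rewrite !inE subsetD1 andbAC.
apply/idP/idP.
  rewrite !inE => /andP[wX /andP[sX stX]].
  rewrite (sub_stable (subsetUr _ _) stX) andbT.
  apply/subsetP => y yX; rewrite !inE (subsetP sX) ?inE ?yX ?orbT // andbT.
  rewrite (stableP _ stX) ?inE ?eqxx ?yX ?orbT //=.
  by apply: contraNneq wX => <-.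
rewrite inE => /andP[sX stX].
have wX : w \notin X.
  by apply/negP => /(subsetP sX); rewrite !inE eqxx andbF.
have nX y : y \in X -> ~~ e w y.
  by move/(subsetP sX); rewrite !inE => /and3P[+ _ yN]; rewrite yN.
rewrite !inE wX /=; apply/andP; split.
  apply/subsetP => y /setU1P[->//|/(subsetP sX)].
  by rewrite !inE => /and3P[].
apply/stableP => x y /setU1P[->|xX] /setU1P[->|yX].
- by rewrite e_irr.
- exact: nX.
- by rewrite e_sym nX.
- exact: (stableP _ stX).
Qed.

Lemma num_stable_le N : num_stable N <= 2 ^ #|N|.
Proof.
rewrite -card_powerset; apply/subset_leq_card/subsetP => X.
by rewrite !inE => /andP[].
Qed.

Lemma num_stable0 : num_stable set0 = 1.
Proof.
apply/eqP; rewrite eqn_leq (leq_trans (num_stable_le _)) ?cards0 //.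
apply/card_gt0P; exists set0; rewrite inE sub0set /=.
by apply/stableP => x y; rewrite inE.
Qed.

(** Stable sets satisfy with equality the recursion that [upclosed_rec] gives as an inequality, so
    induction on [N] compares the two counts. *)
Lemma upclosed_le A N :
  (forall x y, x \in N -> y \in N -> e x y -> (x, y) \notin A -> (y, x) \in A) ->
  #|upclosed A N| <= num_stable N.
Proof.
have [m] := ubnP #|N|; elim: m N => // m IH N lt_m oA.
have [->|[w wN]] := set_0Vmem N; first by rewrite num_stable0 upclosed0.
have lt_w : #|N :\ w| < m by rewrite (cardsD1E wN) in lt_m.
have sub (M : {set T}) : M \subset N ->
  forall x y, x \in M -> y \in M -> e x y -> (x, y) \notin A -> (y, x) \in A.
  by move=> /subsetP sM x y xM yM; apply: oA; apply: sM.
have s1 : N :\ w \subset N by rewrite subsetDl.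
have s2 : N :\ w :\: nbh N w \subset N :\ w by rewrite subsetDl.
rewrite (num_stable_rec wN) (leq_trans (upclosed_rec wN _)) //.
  by move=> x xN; apply: oA.
apply: leq_add; apply: IH => //; first exact: sub.
- exact: leq_ltn_trans (subset_leq_card s2) lt_w.
- by apply: sub; apply: subset_trans s1.
Qed.

Lemma num_trans_le S v : v \in S ->
  num_trans S <= num_trans (S :\ v) * num_stable (nbh S v).
Proof.
move=> vS; apply: leq_trans (num_trans_del vS) _.
rewrite /num_trans -sum1dep_card big_distrl /=; apply: leq_sum => B.
case/andP=> /forallP oB _; rewrite mul1n; apply: upclosed_le => x y xN yN exy nxy.
have xS := subsetP (nbh_subD1 S v) _ xN; have yS := subsetP (nbh_subD1 S v) _ yN.
by have := forallP (oB x) y; rewrite xS yS exy (negPf nxy) /= => ->.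
Qed.

(** * Stable sets in graphs of given minimum degree *)

Lemma card_nbh_rest N w : w \in N ->
  #|N :\ w :\: nbh N w| + #|nbh N w| = #|N :\ w|.
Proof.
move=> wN; rewrite addnC -[RHS](cardsID (nbh N w)).
by congr (_ + _); rewrite (setIidPr _) ?nbh_subD1.
Qed.

(** [k] bounds the number of vertices of [N] other than [w] and not adjacent to it; a stable set
    containing [w] can only add such vertices. *)
Lemma num_stable_rec_le N w k : w \in N -> #|N| <= k + #|nbh N w|.+1 ->
  num_stable N <= num_stable (N :\ w) + 2 ^ k.
Proof.
move=> wN le_k; rewrite (num_stable_rec wN) leq_add2l.
apply: leq_trans (num_stable_le _) _; rewrite leq_exp2l //.
have := card_nbh_rest wN; rewrite (cardsD1E wN) in le_k; lia.
Qed.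

(** An edge forbids one of the four possible traces on its two ends. *)
Lemma num_stable_edge N m : #|N| = m.+2 -> ~~ stable N ->
  num_stable N <= 3 * 2 ^ m.
Proof.
move=> cN /stablePn[x [y [xN yN exy]]].
have h : 0 < #|nbh N x| by apply/card_gt0P; exists y; rewrite in_nbh yN.
apply: leq_trans (num_stable_rec_le (k := m) xN _) _; first lia.
have := num_stable_le (N :\ x).
have -> : #|N :\ x| = m.+1 by move: (cardsD1E xN); lia.
by rewrite expnS; lia.
Qed.

(** The graph is a perfect matching; the edge at [w] is a component and contributes a factor 3. *)
Lemma num_stable_matching N w : w \in N -> mindeg 1 N ->
  (forall u, u \in N -> #|nbh N u| <= 1) ->
  exists2 u, num_stable N = 3 * num_stable (N :\ w :\ u) &
    u \in N :\ w /\ mindeg 1 (N :\ w :\ u).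
Proof.
move=> wN md le1.
have nbh1 x y : x \in N -> y \in nbh N x -> nbh N x = [set y].
  move=> xN yx; apply/esym/eqP; rewrite eqEcard sub1set yx cards1; exact: le1.
have /card_gt0P[u uw] := md w wN.
have [uN ewu] : u \in N /\ e w u by apply/andP; rewrite -in_nbh.
have wu : w \in nbh N u by rewrite in_nbh wN e_sym.
have uw' : u != w by apply: contraTneq ewu => ->; rewrite e_irr.
have uD : u \in N :\ w by rewrite !inE uw'.
exists u.
  rewrite (num_stable_rec wN) (num_stable_rec uD) (nbh1 w u) //.
  have -> : nbh (N :\ w) u = set0.
    apply/setP => x; have /setP/(_ x) := nbh1 u w uN wu.
    by rewrite !inE => /esym eq_xw; rewrite -andbA -eq_xw andNb.
  by rewrite setD0; lia.
split=> // x; rewrite !inE => /and3P[xu xw xN].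
have /card_gt0P[y yx] := md x xN; apply/card_gt0P; exists y.
have := yx; rewrite !inE => /andP[yN exy]; rewrite yN exy !andbT /=.
have ynb : x \in nbh N y by rewrite in_nbh xN e_sym.
apply/andP; split; apply: contraTneq ynb => ->.
  by rewrite (nbh1 u w) // inE.
by rewrite (nbh1 w u) // inE.
Qed.

(** Minimum degree 1 joins every vertex of [N :\ u] to [u], so the stable sets are the sets of
    leaves and the singleton of [u]. *)
Lemma num_stable_star N u m : #|N| = m.+2 -> mindeg 1 N -> u \in N ->
  stable (N :\ u) -> num_stable N <= (2 ^ m.+1).+1.
Proof.
move=> cN md uN /stableP st; have cD := cardsD1E uN.
have nE : nbh N u = N :\ u.
  apply/eqP; rewrite eqEsubset nbh_subD1; apply/subsetP => x xD.
  have /setD1P[_ xN] := xD; have /card_gt0P[y] := md x xN.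
  rewrite !inE => /andP[yN exy]; rewrite xN /= e_sym.
  case: (eqVneq y u) exy => [-> //|yu exy].
  by have := st x y xD; rewrite !inE yu yN exy => /(_ isT).
have := @num_stable_rec_le N u 0 uN; rewrite nE cD => /(_ (leqnn _)).
have := num_stable_le (N :\ u); have -> : #|N :\ u| = m.+1 by lia.
by rewrite expn0; lia.
Qed.

(** If [u] has degree at least 2 and [N :\ u] contains an edge, at most 3 * 2^(m-1) stable sets
    avoid [u] and at most 2^(m-1) contain it. *)
Lemma num_stable_mindeg1_cases N m : #|N| = m.+2 ->
  [\/ num_stable N <= 2 ^ m.+1, exists2 u, u \in N & stable (N :\ u)
    | forall u, u \in N -> #|nbh N u| <= 1].
Proof.
move=> cN; case: (boolP [forall u in N, #|nbh N u| <= 1]) => [/forall_inP|].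
  by constructor 3.
rewrite negb_forall_in => /exists_inP[u uN]; rewrite -ltnNge => deg2.
case: (boolP (stable (N :\ u))) => st; first by constructor 2; exists u.
constructor 1; have cD := cardsD1E uN.
have dle := subset_leq_card (nbh_subD1 N u).
case: m cN => [|m] cN; first lia.
have le1 := num_stable_edge (m := m) _ st.
have le2 := @num_stable_rec_le N u m uN.
rewrite !expnS; lia.
Qed.

(* Equality holds for stars and for two disjoint edges. *)
Lemma num_stable_mindeg1 N m : #|N| = m.+2 -> mindeg 1 N ->
  num_stable N <= (2 ^ m.+1).+1.
Proof.
have [k] := ubnP m; elim: k N m => // k IH N m lt_mk cN md.
case: (num_stable_mindeg1_cases cN) => [|[u uN st]|le1]; first exact: leqW.
  exact: num_stable_star st.
have [w wN] : exists w, w \in N by apply/card_gt0P; rewrite cN.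
have [u -> [uD md']] := num_stable_matching wN md le1.
have cR : #|N :\ w :\ u| = m by have := cardsD1E wN; have := cardsD1E uD; lia.
case: m => [|[|m]] in cN cR lt_mk *.
- by rewrite (cards0_eq cR) num_stable0.
(* A single remaining vertex would be isolated, against minimum degree 1. *)
- have /card_gt0P[x xR] : 0 < #|N :\ w :\ u| by rewrite cR.
  have := md' x xR; have := subset_leq_card (nbh_subD1 (N :\ w :\ u) x).
  have := cardsD1E xR; lia.
have := IH _ m _ cR md'; have := expn_gt0 2 m; rewrite !expnS; lia.
Qed.

(** For a matching, removing one edge leaves [m] vertices and gives 3 * (2^(m-1) + 1), which is at
    most 2^(m+1) from m = 3 on; m = 2 would admit two disjoint edges, with 9 stable sets. *)
Lemma num_stable_mindeg1_star N m : #|N| = m.+2 -> 3 <= m -> mindeg 1 N ->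
  num_stable N <= 2 ^ m.+1 \/ exists2 u, u \in N & stable (N :\ u).
Proof.
move=> cN m3 md.
case: (num_stable_mindeg1_cases cN) => [|star|le1]; [by left|by right|left].
have [w wN] : exists w, w \in N by apply/card_gt0P; rewrite cN.
have [u -> [uD md']] := num_stable_matching wN md le1.
have cR : #|N :\ w :\ u| = m by have := cardsD1E wN; have := cardsD1E uD; lia.
case: m => [|[|[|m]]] // in cN cR m3 *.
have := num_stable_mindeg1 cR md'; have := expn_gt0 2 m; rewrite !expnS; lia.
Qed.

(** Induction on [q]: deleting any vertex lowers the minimum degree by at most one, keeps [m], and
    loses at most 2^m stable sets, since a vertex has at most [m] non-neighbours. *)
Lemma num_stable_mindeg N q m : #|N| = q + m.+1 -> 0 < q -> mindeg q N ->
  num_stable N <= (q.+1 * 2 ^ m).+1.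
Proof.
case: q => // q; elim: q N => [|q IH] N cN _ md.
  by have := num_stable_mindeg1 cN md; rewrite expnS.
have [w wN] : exists w, w \in N by apply/card_gt0P; rewrite cN.
have cD : #|N :\ w| = q.+1 + m.+1 by move: (cardsD1E wN); lia.
have /(_ isT) := IH _ cD _ (mindeg_D1 md).
have := num_stable_rec_le (k := m) wN _; have := md w wN; lia.
Qed.

Lemma nbh_complete N w : complete N -> w \in N -> nbh N w = N :\ w.
Proof.
move=> /completeP cN wN; apply/setP => x; rewrite !inE andbC.
case: (boolP (x \in N)) => xN; rewrite ?andbF // !andbT.
by case: eqVneq => [->|xw]; rewrite ?e_irr // cN // eq_sym.
Qed.

Lemma num_stable_complete N : complete N -> num_stable N <= #|N|.+1.
Proof.
move=> cN; have [k] := ubnP #|N|; elim: k N cN => // k IH N cN lt_k.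
have [->|[w wN]] := set_0Vmem N; first by rewrite num_stable0.
have := @num_stable_rec_le N w 0 wN; rewrite nbh_complete // (cardsD1E wN).
have cD : complete (N :\ w) by apply: sub_complete cN; rewrite subsetDl.
by have := IH _ cD; have := cardsD1E wN; rewrite expn0; lia.
Qed.

(* As x and y are not adjacent, y keeps its full degree in N :\ x. *)
Lemma num_stable_rec2 N x y j k : x \in N -> y \in N -> x != y -> ~~ e x y ->
    #|N| <= j + #|nbh N x|.+1 -> #|N| <= k + #|nbh N y|.+2 ->
  num_stable N <= num_stable (N :\ x :\ y) + 2 ^ k + 2 ^ j.
Proof.
move=> xN yN xy nxy lej lek.
have yD : y \in N :\ x by rewrite !inE eq_sym xy.
have := num_stable_rec_le xN lej.
have := @num_stable_rec_le (N :\ x) y k yD; rewrite nbhD1_nonadj 1?e_sym //.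
have := cardsD1E xN; lia.
Qed.

(** Saves one over [num_stable_mindeg], which gives 2^(m+3) + 1. Removing two non-adjacent vertices
    costs 2^(m+1) + 2^m and leaves minimum degree at least 1. *)
Lemma num_stable_mindeg3 N m : #|N| = m + 5 -> mindeg 3 N ->
  num_stable N <= 2 ^ m.+3.
Proof.
move=> cN md; case: (boolP (complete N)) => [/num_stable_complete|].
  by have := ltn_expl m (isT : 1 < 2); rewrite !expnS; lia.
case/completePn=> x [y [xN yN xy nxy]].
have yD : y \in N :\ x by rewrite !inE eq_sym xy.
have cR : #|N :\ x :\ y| = m.+3 by have := cardsD1E xN; have := cardsD1E yD; lia.
have := num_stable_mindeg1 cR (mindeg_D1 (mindeg_D1 md)).
have := num_stable_rec2 (j := m.+1) (k := m) xN yN xy nxy.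
have := md x xN; have := md y yN; have := expn_gt0 2 m; rewrite !expnS; lia.
Qed.

(** Saves one over [num_stable_mindeg], which gives 13. If an edge survives the removal of two
    non-adjacent vertices, the count is at most 6 + 2 + 4. *)
Lemma num_stable_mindeg2_card5 N : #|N| = 5 -> mindeg 2 N -> num_stable N <= 12.
Proof.
move=> cN md; case: (boolP (complete N)) => [/num_stable_complete|].
  by rewrite cN => /leq_trans; apply.
case/completePn=> x [y [xN yN xy nxy]].
have yD : y \in N :\ x by rewrite !inE eq_sym xy.
have cR : #|N :\ x :\ y| = 3 by have := cardsD1E xN; have := cardsD1E yD; lia.
case: (boolP (stable (N :\ x :\ y))) => [/stableP st|st]; last first.
  have := num_stable_edge (m := 1) cR st; have := md x xN; have := md y yN.
  have := num_stable_rec2 (j := 2) (k := 1) xN yN xy nxy; rewrite !expnS; lia.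
(* If the three other vertices are stable, degree 2 joins each of them to both [x] and [y]. The
   graph is then K_{2,3}, and the recursion gives 8 + 1 + 2. *)
have sub z : z \in N :\ x :\ y -> [set x; y] = nbh N z.
  move=> zR; have zN : z \in N by move: zR; rewrite !inE => /and3P[].
  apply/esym/eqP; rewrite eqEcard cards2 xy (md z zN) andbT.
  apply/subsetP => u; rewrite in_nbh => /andP[uN]; apply: contraTT.
  by rewrite !inE negb_or => /andP[ux uy]; rewrite st // !inE uy ux.
have sx : N :\ x :\ y \subset nbh N x.
  apply/subsetP => z zR; have zN : z \in N by move: zR; rewrite !inE => /and3P[].
  by have /setP/(_ x) := sub z zR; rewrite !inE eqxx zN xN /= e_sym => <-.
have sy : N :\ x :\ y \subset nbh N y.
  apply/subsetP => z zR; have zN : z \in N by move: zR; rewrite !inE => /and3P[].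
  by have /setP/(_ y) := sub z zR; rewrite !inE eqxx orbT zN yN /= e_sym => <-.
have := num_stable_le (N :\ x :\ y).
have := subset_leq_card sx; have := subset_leq_card sy; rewrite cR.
have := num_stable_rec2 (j := 1) (k := 0) xN yN xy nxy; rewrite !expnS; lia.
Qed.


(** * The neighbourhood of a vertex of minimum degree *)

Lemma exists_mindeg S : 0 < #|S| -> exists2 v, v \in S & mindeg #|nbh S v| S.
Proof.
case/card_gt0P=> v0 v0S; case: (arg_minnP (fun v => #|nbh S v|) v0S) => v vS vmin.
by exists v.
Qed.

(** Inclusion-exclusion for the neighbourhoods of [v] and [w] inside [S]. *)
Lemma mindeg_nbh S v : v \in S -> mindeg #|nbh S v| S ->
  mindeg (2 * #|nbh S v| - #|S|) (nbh S v).
Proof.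
move=> vS md w wN; have wS := subsetP (nbh_sub S v) _ wN.
have -> : nbh (nbh S v) w = nbh S v :&: nbh S w.
  by apply/setP => x; rewrite !inE; case: (x \in S).
have := cardsUI (nbh S v) (nbh S w); have := md w wS.
have : #|nbh S v :|: nbh S w| <= #|S| by rewrite subset_leq_card // subUset !nbh_sub.
lia.
Qed.

Lemma mindeg_le q q' N : q <= q' -> mindeg q' N -> mindeg q N.
Proof. by move=> le_q md w wN; apply: leq_trans (md w wN). Qed.

Lemma mindeg_complete S : mindeg #|S|.-1 S -> complete S.
Proof.
move=> md; apply/completeP => x y xS yS xy.
have nE : nbh S x = S :\ x.
  apply/eqP; rewrite eqEcard nbh_subD1; have := md x xS.
  by rewrite (cardsD1E xS).
have : y \in nbh S x by rewrite nE !inE eq_sym xy.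
by rewrite in_nbh => /andP[].
Qed.

(** * Complete bipartite graphs *)

(** The equality makes the induced graph complete bipartite: all pairs across are edges. *)
Definition bipartition S X :=
  X \subset S /\ {in S &, forall x y, e x y = ((x \in X) != (y \in X))}.

Definition balanced S := exists2 X, bipartition S X & #|X| = #|S|./2.

(** There are no triangles, so every orientation of the |X| * |Y| edges counts. *)
Lemma num_trans_bipartition S X : bipartition S X ->
  num_trans S = 2 ^ (#|X| * (#|S| - #|X|)).
Proof.
case=> /subsetP sX eX; pose Y := S :\: X.
have inY y : (y \in Y) = (y \notin X) && (y \in S) by rewrite inE.
(* [Z] lists the edges directed from [X] to [Y]; [f Z] directs the others from [Y] to [X]. *)
pose f (Z : {set T * T}) : {set T * T} :=
  [set a | if a.1 \in X then (a.2 \in Y) && (a \in Z)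
           else [&& a.1 \in Y, a.2 \in X & (a.2, a.1) \notin Z]].
have -> : #|S| - #|X| = #|Y|.
  by rewrite cardsD (setIidPr _) //; apply/subsetP.
rewrite -cardsX -card_powerset /num_trans.
have <- : #|f @: powerset (setX X Y)| = #|powerset (setX X Y)|.
  apply: card_in_imset => Z1 Z2; rewrite !inE => /subsetP s1 /subsetP s2 /setP eqf.
  apply/setP => -[x y]; have := eqf (x, y); rewrite !inE /=.
  case: (boolP (x \in X)) => xX; last first.
    have notin (Z : {set T * T}) : {subset Z <= setX X Y} -> (x, y) \in Z = false.
      by move=> sZ; apply/negP => /sZ; rewrite inE /= (negPf xX).
    by rewrite !notin.
  case: (boolP (y \in Y)) => yY; first by rewrite -inY yY.
  have notin (Z : {set T * T}) : {subset Z <= setX X Y} -> (x, y) \in Z = false.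
    by move=> sZ; apply/negP => /sZ; rewrite inE /= (negPf yY) andbF.
  by rewrite !notin.
apply: eq_card => A; rewrite inE; apply/idP/imsetP.
  case/andP=> /forallP oA _; exists (A :&: setX X Y); first by rewrite inE subsetIr.
  apply/setP => -[x y]; rewrite !inE /=.
  have := forallP (oA x) y; case: (boolP (x \in S)) => xS /=; last first.
    move/negPf=> ->; case: ifP => [/sX|_]; first by rewrite (negPf xS).
    by rewrite andbF.
  case: (boolP (y \in S)) => yS /=; last first.
    move/negPf=> ->; rewrite !andbF; case: ifP => // _.
    by case: (boolP (y \in X)) => [/sX|]; rewrite ?(negPf yS) ?andbF.
  rewrite eX // ?andbT; case: (x \in X); case: (y \in X); rewrite ?andbT ?andbF //=.
  - by move/negPf.
  - by case: (_ \in A); case: (_ \in A).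
  - by move/negPf.
case=> Z; rewrite inE => /subsetP sZ ->; apply/andP.
have fX x y : (x, y) \in f Z -> (x \in X) != (y \in X).
  rewrite inE /= !inY; case: ifP => [_ /andP[/andP[/negPf->]]|_ /and3P[_ -> _]] //.
have fS x y : (x, y) \in f Z -> (x \in S) && (y \in S).
  rewrite inE /= !inY; case: ifP => [/sX xS /andP[/andP[_ yS] _]|_].
    by rewrite xS.
  by case/and3P=> /andP[_ xS] /sX yS _; rewrite xS.
split.
  apply/forallP => x; apply/forallP => y; case: ifP => [/and3P[xS yS]|].
    rewrite eX // !inE /= xS yS !andbT.
    by case: (x \in X); case: (y \in X) => //= _; case: (_ \in Z).
  by apply: contraFN => xyZ; case/andP: (fS _ _ xyZ) => xS yS; rewrite eX ?xS ?yS ?fX.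
apply/forallP => x; apply/forallP => y; apply/forallP => z.
apply/negP => /and3P[/fX + /fX + /fX].
by case: (x \in X); case: (y \in X); case: (z \in X).
Qed.

Lemma bipartitionC S X : bipartition S X -> bipartition S (S :\: X).
Proof.
case=> sX eX; split=> [|x y xS yS]; first exact: subsetDl.
by rewrite !inE xS yS !andbT eX //; case: (_ \in X); case: (_ \in X).
Qed.

Lemma bipartition_add S X v : v \in S -> bipartition (S :\ v) X ->
  nbh S v = S :\ v :\: X -> bipartition S (v |: X).
Proof.
move=> vS [sX eX] nE; split.
  by rewrite subUset sub1set vS (subset_trans sX) ?subsetDl.
have vX : v \notin X by apply/negP => /(subsetP sX); rewrite !inE eqxx.
have ev x : x \in S -> x != v -> e v x = (x \notin X).
  by move=> xS xv; have /setP/(_ x) := nE; rewrite in_nbh !inE xS xv /= andbT.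
move=> x y xS yS; rewrite !inE.
case: (eqVneq x v) => [->|xv]; case: (eqVneq y v) => [->|yv] /=.
- by rewrite e_irr.
- by rewrite ev //; case: (_ \in X).
- by rewrite e_sym ev //; case: (_ \in X).
- by rewrite eX // !inE ?xv ?yv.
Qed.

(* If the neighbourhood L of a vertex of minimum degree k is stable, then all
   vertices of L are joined to all of S :\: L. *)
Lemma stable_nbh_half S v k : #|S| = k.*2 -> 0 < k -> mindeg k S ->
    #|nbh S v| = k -> stable (nbh S v) ->
  balanced S \/ exists l, [/\ l \in S, #|nbh S l| = k & ~~ stable (nbh S l)].
Proof.
move=> cS k0 md cL /stableP stL; pose L := nbh S v; pose R := S :\: L.
have sL : L \subset S by exact: nbh_sub.
have cR : #|R| = k by rewrite cardsD (setIidPr sL) cS cL; lia.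
have nR l : l \in L -> nbh S l = R.
  move=> lL; apply/eqP; rewrite eqEcard cR (md l (subsetP sL _ lL)) andbT.
  apply/subsetP => x; rewrite inE => /andP[xS elx]; rewrite in_setD xS andbT.
  by apply: contraTN elx => xL; apply: stL.
case: (boolP (stable R)) => [/stableP stR|stR]; last first.
  have /card_gt0P[l lL] : 0 < #|L| by rewrite cL.
  by right; exists l; rewrite nR // cR (subsetP sL).
left; exists L; last by rewrite cL cS doubleK.
split=> // x y xS yS.
have eLR l r : l \in L -> r \in S -> r \notin L -> e l r.
  move=> lL rS rL; have /setP/(_ r) := nR l lL.
  by rewrite in_nbh in_setD rS rL => /andP[].
case: (boolP (x \in L)) => xL; case: (boolP (y \in L)) => yL /=.
- exact/negbTE/stL.
- exact: eLR.
- by rewrite e_sym; apply: eLR.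
- by apply/negbTE/stR; rewrite in_setD ?xL ?yL.
Qed.

(** * Bounds for at most seven vertices *)

Lemma num_trans_step S n : #|S| = n.+1 ->
  exists v, let d := #|nbh S v| in
  [/\ v \in S, #|S :\ v| = n, mindeg d S & d <= n] /\
  [/\ mindeg (2 * d - n.+1) (nbh S v), complete S \/ d < n &
     forall a b, num_trans (S :\ v) <= a -> num_stable (nbh S v) <= b ->
       num_trans S <= a * b].
Proof.
move=> cS; have [|v vS md] := @exists_mindeg S; first by rewrite cS.
have cD : #|S :\ v| = n by have := cardsD1E vS; lia.
have dn := subset_leq_card (nbh_subD1 S v); rewrite cD in dn.
exists v; split; split=> //; first by rewrite -cS; apply: mindeg_nbh.
  rewrite ltn_neqAle dn andbT; case: eqVneq => [dE|]; [left|by right].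
  by apply: mindeg_complete; rewrite cS -dE.
by move=> a b ha hb; apply: leq_trans (num_trans_le vS) (leq_mul ha hb).
Qed.

Lemma num_stable_le_card N m : #|N| <= m -> num_stable N <= 2 ^ m.
Proof. by move=> le_m; rewrite (leq_trans (num_stable_le N)) ?leq_exp2l. Qed.

Lemma num_trans_card0 S : #|S| = 0 -> num_trans S <= 1.
Proof.
move/cards0_eq->; rewrite -(cards1 (set0 : {set T * T})).
apply/subset_leq_card/subsetP => A; rewrite !inE => /andP[/forallP oA _].
apply/eqP/setP => -[x y]; rewrite !inE; have := forallP (oA x) y.
by rewrite inE => /negPf.
Qed.

Lemma num_trans_card2 S : #|S| = 2 -> num_trans S <= 2.
Proof.
have h1 S1 : #|S1| = 1 -> num_trans S1 <= 1.
  move=> /num_trans_step[v [[_ cD _ d0] [_ _ mul]]].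
  exact: (mul 1 1 (num_trans_card0 cD) (num_stable_le_card d0)).
move=> /num_trans_step[v [[_ cD _ d1] [_ _ mul]]].
exact: (mul 1 2 (h1 _ cD) (num_stable_le_card d1)).
Qed.

(** From 3 to 6 vertices the first bound is n!, the number of linear orders, attained by complete
    graphs; the smaller bound for incomplete graphs provides the slack used later. *)
Lemma num_trans_card3 S : #|S| = 3 ->
  num_trans S <= 6 /\ (~~ complete S -> num_trans S <= 4).
Proof.
move=> /num_trans_step[v [[vS cD md d2] [mdN cS mul]]].
have hD := num_trans_card2 cD.
case: cS => [cS|d1].
  rewrite cS; split=> //.
  have cN := sub_complete (nbh_sub S v) cS.
  by apply: (mul 2 3) => //; apply: leq_trans (num_stable_complete cN) _.
have : num_trans S <= 4 by apply: (mul 2 2) => //; apply: (@num_stable_le_card _ 1).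
by move=> h4; split=> // ; apply: leq_trans h4 _.
Qed.

Lemma stable_ncomplete S N : N \subset S -> 1 < #|N| -> stable N -> ~~ complete S.
Proof.
move=> /subsetP sN /card_gt1P[x [y [xN yN xy]]] /stableP st.
by apply/completePn; exists x, y; rewrite !sN // st.
Qed.

Lemma num_trans_card4 S : #|S| = 4 ->
  num_trans S <= 24 /\ (~~ complete S -> num_trans S <= 18).
Proof.
move=> /num_trans_step[v [[vS cD md d3] [mdN cS mul]]].
have [hD hD'] := num_trans_card3 cD.
case: cS => [cS|d2].
  rewrite cS; split=> //.
  have cN := sub_complete (nbh_sub S v) cS.
  by apply: (mul 6 4) => //; apply: leq_trans (num_stable_complete cN) _.
suff h : num_trans S <= 18 by split=> //; apply: leq_trans h _.
move: d2; rewrite leq_eqVlt => /orP[/eqP[d2]|d1]; last first.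
  by apply: leq_trans (mul 6 2 _ (@num_stable_le_card _ 1 _)) _.
case: (boolP (stable (nbh S v))) => st.
  have nc : ~~ complete (S :\ v) by apply: stable_ncomplete (nbh_subD1 _ _) _ st; rewrite d2.
  by apply: leq_trans (mul 4 4 (hD' nc) (@num_stable_le_card _ 2 _)) _; rewrite // d2.
exact: (mul 6 3 hD (@num_stable_edge _ 0 d2 st)).
Qed.

Lemma num_trans_card5 S : #|S| = 5 ->
  num_trans S <= 120 /\ (~~ complete S -> num_trans S <= 96).
Proof.
move=> /num_trans_step[v [[vS cD md d4] [mdN cS mul]]].
have [hD hD'] := num_trans_card4 cD.
case: cS => [cS|d3].
  rewrite cS; split=> //.
  have cN := sub_complete (nbh_sub S v) cS.
  by apply: (mul 24 5) => //; apply: leq_trans (num_stable_complete cN) _.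
suff h : num_trans S <= 96 by split=> //; apply: leq_trans h _.
move: d3; rewrite leq_eqVlt => /orP[/eqP[d3]|d2]; last first.
  exact: (mul 24 4 hD (@num_stable_le_card _ 2 _)).
case: (boolP (complete (S :\ v))) => [cDv|nc].
  have cN := sub_complete (nbh_subD1 S v) cDv.
  by apply: (mul 24 4) => //; have := num_stable_complete cN; rewrite d3.
rewrite d3 in mdN.
by apply: leq_trans (mul 18 5 (hD' nc) (@num_stable_mindeg1 _ 1 d3 mdN)) _.
Qed.


(** The bound 600 serves the degree 4 case on seven vertices, where it meets a factor 9; the
    products found here are at most 576. *)
Lemma num_trans_card6 S : #|S| = 6 ->
  [/\ num_trans S <= 720, ~~ complete S -> num_trans S <= 672 &
      ~ mindeg 4 S -> num_trans S <= 600].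
Proof.
move=> cS6; have [v [[vS cD md d5] [mdN cS mul]]] := num_trans_step cS6.
have [hD hD'] := num_trans_card5 cD.
case: cS => [cS|d4].
  have cN := sub_complete (nbh_sub S v) cS; rewrite cS.
  split=> // [|[]]; last by move=> w wS; rewrite nbh_complete //; have := cardsD1E wS; lia.
  by apply: (mul 120 6) => //; apply: leq_trans (num_stable_complete cN) _.
move: d4; rewrite leq_eqVlt => /orP[/eqP[d4]|d3].
  suff h : num_trans S <= 672.
    split=> //; first exact: leq_trans h _.
    by case; move: md; rewrite d4.
  case: (boolP (complete (S :\ v))) => [cDv|nc].
    have cN := sub_complete (nbh_subD1 S v) cDv.
    apply: leq_trans (mul 120 5 hD _) _ => //.
    by apply: leq_trans (num_stable_complete cN) _; rewrite d4.
  rewrite d4 in mdN.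
  by apply: leq_trans (mul 96 7 (hD' nc) (@num_stable_mindeg _ 2 1 d4 _ mdN)) _.
suff h : num_trans S <= 600 by split=> // [|_]; apply: leq_trans h _.
move: d3; rewrite leq_eqVlt => /orP[/eqP[d3]|d2]; last first.
  by apply: leq_trans (mul 120 4 hD (@num_stable_le_card _ 2 _)) _.
have nst l : l \in S -> #|nbh S l| = 3 -> ~~ stable (nbh S l) ->
    num_trans S <= 600.
  move=> lS d3l st; have cDl : #|S :\ l| = 5 by have := cardsD1E lS; lia.
  have [hDl hDl'] := num_trans_card5 cDl; apply: leq_trans (num_trans_le lS) _.
  case: (boolP (complete (S :\ l))) => [cDv|nc].
    have cN := num_stable_complete (sub_complete (nbh_subD1 S l) cDv).
    by rewrite d3l in cN; apply: leq_trans (leq_mul hDl cN) _.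
  by apply: leq_trans (leq_mul (hDl' nc) (@num_stable_edge _ 1 d3l st)) _.
(* With a stable neighbourhood, either the graph is K_{3,3}, with 2^9 orientations, or another
   vertex of degree 3 has an edge in its neighbourhood. *)
case: (boolP (stable (nbh S v))) => st; last exact: nst st.
rewrite d3 in md.
case: (@stable_nbh_half S v 3 cS6 isT md d3 st) => [|[l [lS dl stl]]].
  by case=> X bX cX; rewrite (num_trans_bipartition bX) cX cS6.
exact: nst stl.
Qed.

(** 5400 = 600 * 9 is small enough for both later uses: 12 * 5400 < 2^16 and 3 * 5400 <= 4 *
    2^12. *)
Lemma num_trans_card7 S : #|S| = 7 -> num_trans S <= 5400.
Proof.
move=> cS7; have [v [[vS cD md d6] [mdN cS mul]]] := num_trans_step cS7.
have [hD hD' hD''] := num_trans_card6 cD.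
have tr a b : num_trans (S :\ v) <= a -> num_stable (nbh S v) <= b ->
    a * b <= 5400 -> num_trans S <= 5400.
  by move=> ha hb; apply: leq_trans (mul a b ha hb).
case: cS => [cS|d5].
  apply: (tr 720 7) => //; apply: leq_trans (num_stable_complete _) _ => //.
  exact: sub_complete (nbh_sub S v) cS.
move: d5; rewrite leq_eqVlt => /orP[/eqP[d5]|].
  case: (boolP (complete (S :\ v))) => [cDv|nc].
    apply: (tr 720 6) => //; have := sub_complete (nbh_subD1 S v) cDv.
    by move/num_stable_complete; rewrite d5.
  rewrite d5 in mdN.
  exact: (tr 672 8 (hD' nc) (@num_stable_mindeg3 _ 0 d5 mdN)).
rewrite ltnS leq_eqVlt => /orP[/eqP[d4]|].
  (* If the six other vertices have minimum degree 4, each neighbour of [v] has at least 4 + 4 - 6 =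
     2 neighbours inside the neighbourhood, which lowers the factor from 9 to 7. *)
  case: (boolP [forall w in S :\ v, 4 <= #|nbh (S :\ v) w|]) => [/forall_inP md4|].
    apply: (tr 720 7) => //; apply: (@num_stable_mindeg _ 2 1 d4) => // w wN.
    have wD := subsetP (nbh_subD1 S v) _ wN.
    have := md4 w wD; have := cardsUI (nbh (S :\ v) w) (nbh S v).
    have : nbh (S :\ v) w :&: nbh S v \subset nbh (nbh S v) w.
      by apply/subsetP => x; rewrite !inE => /andP[/andP[_ ->] ->].
    move/subset_leq_card.
    have : nbh (S :\ v) w :|: nbh S v \subset S :\ v.
      by rewrite subUset nbh_sub nbh_subD1.
    by move/subset_leq_card; rewrite cD d4; lia.
  move=> nmd; rewrite d4 in mdN.
  apply: (tr 600 9 (hD'' _) (@num_stable_mindeg1 _ 2 d4 mdN)) => // md4.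
  by move/negP: nmd; apply; apply/forall_inP.
rewrite ltnS leq_eqVlt => /orP[/eqP[d3]|d2].
  case: (boolP (stable (nbh S v))) => st.
    have nc : ~~ complete (S :\ v) by apply: stable_ncomplete (nbh_subD1 _ _) _ st; rewrite d3.
    by apply: (tr 672 8 (hD' nc) (@num_stable_le_card _ 3 _)); rewrite ?d3.
  exact: (tr 720 6 hD (@num_stable_edge _ 1 d3 st)).
exact: (tr 720 4 hD (@num_stable_le_card _ 2 _)).
Qed.

(** * The extremal number and the base case of eight vertices *)

Definition turan n := n./2 * uphalf n.

Lemma turanS n : turan n.+1 = turan n + n.+1./2.
Proof. by rewrite /turan /= uphalf_half; have := odd_double_half n; nia. Qed.

Lemma num_trans_balanced S : balanced S -> num_trans S = 2 ^ turan #|S|.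
Proof.
case=> X bX cX; rewrite (num_trans_bipartition bX) cX /turan.
by congr (2 ^ (_ * _)); rewrite uphalf_half; have := odd_double_half #|S|; lia.
Qed.

(** The alternative carries uniqueness through the induction: the bound is strict or the graph is
    extremal. *)
Definition turan_bound S := num_trans S < 2 ^ turan #|S| \/ balanced S.

Lemma turan_bound_le S : turan_bound S -> num_trans S <= 2 ^ turan #|S|.
Proof. by case=> [/ltnW|/num_trans_balanced->]. Qed.

(** Unless the graph is K_{4,4}, some neighbourhood has at most 12 stable subsets, and 12 * 5400 =
    64800 < 65536 = 2^16. *)
Lemma num_trans_card8 S : #|S| = 8 -> turan_bound S.
Proof.
move=> cS8; have [v [[vS cD md d7] [mdN cS mul]]] := num_trans_step cS8.
have nst l : l \in S -> num_stable (nbh S l) <= 12 -> turan_bound S.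
  move=> lS le12; left; apply: leq_ltn_trans (num_trans_le lS) _.
  have cDl : #|S :\ l| = 7 by have := cardsD1E lS; lia.
  apply: leq_ltn_trans (leq_mul (num_trans_card7 cDl) le12) _; rewrite cS8.
  by vm_compute.
have [d4|d4|d4] := ltngtP #|nbh S v| 4.
- by apply: (nst v vS); apply: leq_trans (@num_stable_le_card _ 3 _) _.
- apply: (nst v vS); move: d7 mdN; move: d4.
  rewrite leq_eqVlt => /orP[/eqP/esym d5 _|]; rewrite ?d5.
    exact: num_stable_mindeg2_card5.
  rewrite leq_eqVlt => /orP[/eqP/esym d6 _|]; rewrite ?d6.
    by move=> mdN; apply: leq_trans (@num_stable_mindeg _ 4 1 d6 _ mdN) _.
  move=> d7 d7'; have {d7 d7'} d7 : #|nbh S v| = 7 by lia.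
  by rewrite d7 => mdN; apply: leq_trans (@num_stable_mindeg _ 6 0 d7 _ mdN) _.
case: (boolP (stable (nbh S v))) => st; last first.
  exact: nst vS (@num_stable_edge _ 2 d4 st).
rewrite d4 in md.
case: (@stable_nbh_half S v 4 cS8 isT md d4 st) => [|[l [lS dl stl]]]; first by right.
exact: nst lS (@num_stable_edge _ 2 dl stl).
Qed.

(** * The inductive step and its equality case *)

(** The hypotheses force [v] to have degree exactly [k] and a stable neighbourhood, which must then
    be a whole part of [S :\ v]; so [v] joins the other part. *)
Lemma balanced_add S v k : v \in S -> 1 < k -> #|S|./2 = k ->
  mindeg #|nbh S v| S -> 2 ^ k <= num_stable (nbh S v) ->
  balanced (S :\ v) -> balanced S.
Proof.
move=> vS k1 cS md le_st [X bX cX]; have cD := cardsD1E vS.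
have [sX eX] := bX; pose Y := S :\ v :\: X.
have cXY : #|X| + #|Y| = #|S :\ v|.
  by rewrite /Y cardsD (setIidPr sX) subnKC ?subset_leq_card.
have bY : bipartition (S :\ v) Y by exact: bipartitionC.
have nW W x : bipartition (S :\ v) W -> x \in W ->
    nbh S x \subset v |: (S :\ v :\: W).
  move=> [sW eW] xW; have xS := subsetP sW _ xW.
  apply/subsetP => y; rewrite in_nbh 3!inE => /andP[yS].
  case: (eqVneq y v) => //= yv; have yD : y \in S :\ v by rewrite !inE yv.
  by rewrite eW // xW yD andbT.
have eYX : S :\ v :\: Y = X.
  by rewrite /Y setDDr setDv set0U (setIidPr sX).
have hX x : x \in X -> #|nbh S x| <= #|Y|.+1.
  move=> xX; apply: leq_trans (subset_leq_card (nW X x bX xX)) _.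
  by rewrite cardsU1 -/Y; case: (_ \notin _) => /=; lia.
have hY y : y \in Y -> #|nbh S y| <= #|X|.+1.
  move=> yY; apply: leq_trans (subset_leq_card (nW Y y bY yY)) _.
  by rewrite eYX cardsU1; case: (_ \notin _) => /=; lia.
have kd : k <= #|nbh S v|.
  by rewrite -(leq_exp2l (m := 2)) //; apply: leq_trans le_st (num_stable_le _).
(* A larger degree would need both parts of size [k] and every other vertex adjacent to [v], so 2k
   <= k + 1, against 1 < k. *)
have dk : #|nbh S v| = k.
  have [y yY] : exists y, y \in Y by apply/card_gt0P; lia.
  have yS : y \in S by move: yY; rewrite !inE => /and3P[].
  have := leq_trans (md y yS) (hY y yY).
  case: (leqP #|nbh S v| k) => dk; first lia.
  move=> dk'; have XY : #|X| = k /\ #|Y| = k by lia.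
  suff : #|S :\ v| <= #|nbh S v| by lia.
  apply/subset_leq_card/subsetP => x; rewrite inE => /andP[xv xS].
  rewrite in_nbh xS e_sym.
  have half W : bipartition (S :\ v) W -> #|S :\ v :\: W| = k -> x \in W -> e x v.
    move=> bW cW xW; have sub := nW W x bW xW.
    have : nbh S x == v |: (S :\ v :\: W).
      rewrite eqEcard sub cardsU1 cW (leq_trans _ (md x xS)) //.
      by case: (_ \notin _) => //=; apply: leq_trans _ dk.
    by move/eqP/setP/(_ v); rewrite in_nbh !inE eqxx => /andP[].
  case: (boolP (x \in X)) => xX; first by apply: half xX; rewrite // -/Y; case: XY.
  apply: (half Y) => //; first by rewrite eYX; case: XY.
  by rewrite in_setD xX in_setD xv xS.
have st : stable (nbh S v).
  apply/negPn/negP => st; case: k k1 dk le_st {cS kd} => [|[|k]] // _ dk le_st.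
  have := num_stable_edge dk st; have := expn_gt0 2 k.
  by move: le_st; rewrite !expnS; lia.
have hW W : bipartition (S :\ v) W -> nbh S v = S :\ v :\: W -> balanced S.
  move=> bW nE; have bW' := bipartition_add vS bW nE.
  have [sW _] := bW; have cW : #|W| + k = #|S :\ v|.
    by rewrite -dk nE cardsD (setIidPr sW) subnKC ?subset_leq_card.
  have vW : v \notin W by apply/negP => /(subsetP sW); rewrite !inE eqxx.
  have cvW : #|v |: W| = #|W|.+1 by rewrite cardsU1 vW.
  (* [balanced] asks for the smaller part: for odd |S| the part containing [v] is the larger one. *)
  case: (boolP (odd #|S|)) => od; have := odd_double_half #|S|.
    exists (S :\: (v |: W)); first exact: bipartitionC.
    have [sW' _] := bW'; rewrite cardsD (setIidPr sW'); lia.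
  by exists (v |: W) => //; lia.
(* A stable set lies in one part, and fills it, as no part exceeds [k] vertices. *)
case: (boolP (nbh S v \subset X)) => sNX.
  apply: (hW Y bY); rewrite eYX; apply/eqP; rewrite eqEcard sNX; lia.
apply: (hW X bX); apply/eqP; rewrite eqEcard; apply/andP; split; last by rewrite -/Y; lia.
have /subsetPn[y yN yX] := sNX.
have yD := subsetP (nbh_subD1 S v) _ yN.
apply/subsetP => x xN; have xD := subsetP (nbh_subD1 S v) _ xN.
rewrite in_setD xD andbT; apply: contraTN isT => xX.
by have := stableP _ st x y xN yN; rewrite eX // xX yX.
Qed.

(** By [turanS] the bound grows by the factor 2^k. Strictness of either factor is inherited;
    otherwise [balanced_add] applies. *)
Lemma turan_bound_step S v k : v \in S -> 1 < k -> #|S|./2 = k ->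
    mindeg #|nbh S v| S -> num_stable (nbh S v) <= 2 ^ k ->
  turan_bound (S :\ v) -> turan_bound S.
Proof.
move=> vS k1 cS md le_st hD; have hD' := turan_bound_le hD.
have tE : 2 ^ turan #|S| = 2 ^ turan #|S :\ v| * 2 ^ k.
  by rewrite (cardsD1E vS) turanS expnD -(cardsD1E vS) cS.
have hS := num_trans_le vS.
move: le_st; rewrite leq_eqVlt => /orP[/eqP st|st]; last first.
  left; rewrite tE; apply: leq_ltn_trans hS _.
  by apply: leq_ltn_trans (leq_mul hD' (leqnn _)) _; rewrite ltn_pmul2l ?expn_gt0.
case: hD => [lt|bD].
  rewrite st in hS; left; rewrite tE; apply: leq_ltn_trans hS _.
  by rewrite ltn_pmul2r ?expn_gt0.
by right; apply: (balanced_add vS k1 cS md _ bD); rewrite st.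
Qed.

Lemma num_stable_even_step S v k : #|S| = k.*2 -> v \in S ->
  mindeg #|nbh S v| S -> num_stable (nbh S v) <= 2 ^ k.
Proof.
move=> cS vS md; have mdN := mindeg_nbh vS md.
have dn := subset_leq_card (nbh_subD1 S v); have cD := cardsD1E vS.
case: (leqP #|nbh S v| k) => dk; first exact: num_stable_le_card.
(* The degree is k + x + 1, so the neighbourhood has minimum degree at least 2(x + 1), and the claim
   reduces to 2x + 3 < 2^(x+2). *)
pose x := (#|nbh S v| - k).-1; pose m := k - x.+2.
have dE : #|nbh S v| = 2 * x.+1 + m.+1 by lia.
have kE : k = m + x.+2 by lia.
have md' : mindeg (2 * x.+1) (nbh S v) by apply: mindeg_le mdN; lia.
have := num_stable_mindeg dE isT md'.
have := ltn_expl x.+1 (isT : 1 < 2); rewrite kE expnD.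
have := expn_gt0 2 m; rewrite !expnS; nia.
Qed.


(** At degree k + t the neighbourhood has minimum degree at least 2t - 1. The star exception arises
    for t = 1; for t = 2 the general bound is one too large and [num_stable_mindeg3] replaces it;
    for larger t the general bound suffices. *)
Lemma num_stable_odd_step S v k : #|S| = k.*2.+1 -> 3 < k -> v \in S ->
    mindeg #|nbh S v| S ->
  num_stable (nbh S v) <= 2 ^ k \/
  #|nbh S v| = k.+1 /\ exists2 u, u \in nbh S v & stable (nbh S v :\ u).
Proof.
move=> cS k3 vS md; have mdN := mindeg_nbh vS md.
have dn := subset_leq_card (nbh_subD1 S v); have cD := cardsD1E vS.
case: (leqP #|nbh S v| k) => dk; first by left; apply: num_stable_le_card.
have [d1|d1] := eqVneq #|nbh S v| k.+1.
  case: k => // k in cS k3 dk d1 cD *.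
  have md1 : mindeg 1 (nbh S v) by apply: mindeg_le mdN; lia.
  by case: (num_stable_mindeg1_star d1 k3 md1) => [|star]; [left|right].
left; have [d2|d2] := eqVneq #|nbh S v| k.+2.
  have md3 : mindeg 3 (nbh S v) by apply: mindeg_le mdN; lia.
  have dE : #|nbh S v| = k - 3 + 5 by lia.
  by have := num_stable_mindeg3 dE md3; have -> : (k - 3).+3 = k by lia.
pose x := #|nbh S v| - k - 3; pose m := k - x.+3.
have dE : #|nbh S v| = (2 * x).+3.+2 + m.+1 by lia.
have kE : k = m + x.+3 by lia.
have md' : mindeg (2 * x).+3.+2 (nbh S v) by apply: mindeg_le mdN; lia.
have := num_stable_mindeg dE isT md'.
have := ltn_expl x (isT : 1 < 2); rewrite kE expnD !expnS.
have := expn_gt0 2 m; nia.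
Qed.

(* Here the leaves L of the star are joined to all other vertices. Deleting a
   vertex of L and then v multiplies the bound by at most
   (2 ^ k + 1) (2 ^ (k - 1) + 1), where 2 ^ (2 k) would be affordable. *)
Lemma num_trans_star S v u k : #|S| = k.*2.+1 -> 3 < k -> v \in S ->
    mindeg k.+1 S -> #|nbh S v| = k.+1 -> u \in nbh S v ->
    stable (nbh S v :\ u) ->
    (forall R : {set T}, #|R| = k.*2.-1 -> 3 * num_trans R <= 4 * 2 ^ turan #|R|) ->
  num_trans S < 2 ^ turan #|S|.
Proof.
move=> cS k3 vS md dv uN /stableP stL IH; pose L := nbh S v :\ u.
have cL : #|L| = k by have := cardsD1E uN; rewrite dv => -[].
have sL : L \subset S by apply: subset_trans (subsetDl _ _) (nbh_sub S v).
have nL l : l \in L -> nbh S l = S :\: L.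
  move=> lL; apply/eqP; rewrite eqEcard; apply/andP; split.
    apply/subsetP => x; rewrite inE => /andP[xS elx]; rewrite in_setD xS andbT.
    by apply: contraTN elx => xL; apply: stL.
  rewrite cardsD (setIidPr sL) cS cL; have := md l (subsetP sL _ lL); lia.
have uS := subsetP (nbh_sub S v) _ uN.
have eLu l : l \in L -> e l u.
  by move=> lL; have /setP/(_ u) := nL l lL; rewrite !inE eqxx uS /=.
have /card_gt1P[l [l' [lL l'L ll']]] : 1 < #|L| by lia.
have lS := subsetP sL _ lL.
have vl : v != l by apply: contraTneq lL => <-; rewrite !inE e_irr !andbF.
have vD : v \in S :\ l by rewrite !inE vl.
have dl : #|nbh S l| = k.+1.
  by rewrite nL // cardsD (setIidPr sL) cS cL; clear; lia.
case: k => // k in cS k3 md dv IH cL dl *.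
have h1 : num_stable (nbh S l) <= (2 ^ k.+1).+1.
  apply: (num_stable_mindeg1 dl); apply: mindeg_le (mindeg_nbh lS _).
    by rewrite dl cS; clear; lia.
  by rewrite dl.
have nvE : nbh (S :\ l) v = nbh S v :\ l by apply/setP => x; rewrite !inE andbA.
have cN : #|nbh (S :\ l) v| = k.+1.
  have lN : l \in nbh S v by move: lL; rewrite inE => /andP[].
  by have := cardsD1E lN; rewrite nvE dv => -[].
have h2 : num_stable (nbh (S :\ l) v) <= (2 ^ k).+1.
  case: k => // k in cS k3 md dv IH cL dl cN h1 *.
  apply: (num_stable_mindeg1 cN); rewrite nvE => x /setD1P[xl xN].
  (* After [l] is deleted, the centre [u] still sees the leaf [l'], and every remaining leaf sees
     [u]. *)
  apply/card_gt0P; have [->|xu] := eqVneq x u.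
    exists l'; rewrite in_nbh in_setD1 eq_sym ll' e_sym eLu // andbT.
    by move: l'L; rewrite in_setD1 => /andP[].
  exists u; rewrite in_nbh in_setD1 uN eLu ?in_setD1 ?xu // !andbT.
  by apply: contraTneq lL => <-; rewrite !inE eqxx.
have cD := cardsD1E lS; have cDD := cardsD1E vD.
have tE : turan #|S| = turan #|S :\ l :\ v| + (k.+1 + k.+1).
  rewrite cD turanS -cD cDD turanS -cDD -addnA.
  by congr (_ + (_ + _)); clear -cS cD; lia.
have h3 := IH (S :\ l :\ v) _; rewrite tE expnD.
have h : num_trans S <= num_trans (S :\ l :\ v) * (2 ^ k).+1 * (2 ^ k.+1).+1.
  apply: leq_trans (num_trans_le lS) (leq_mul _ h1).
  exact: leq_trans (num_trans_le vD) (leq_mul _ h2).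
apply: leq_ltn_trans h _.
have {}h3 : 3 * num_trans (S :\ l :\ v) <= 4 * 2 ^ turan #|S :\ l :\ v|.
  by apply: h3; clear -cS cD cDD; lia.
have : 0 < 2 ^ turan #|S :\ l :\ v| by rewrite expn_gt0.
have : 8 <= 2 ^ k by apply: (@leq_trans (2 ^ 3)); rewrite // leq_exp2l.
rewrite expnD expnS; move: (2 ^ k) (2 ^ turan _) (num_trans _) h3 => a b c h3 a8 b0.
have aa : 8 * a <= a * a by rewrite leq_mul2r a8 orbT.
(* With a = 2^k >= 8 for the shifted [k], the two deletions cost (a + 1)(2a + 1), leaving room below
   (2a)^2 for the factor 4/3 of the weaker hypothesis. *)
have X : 4 * (a.+1 * (2 * a).+1) < 3 * (2 * a * (2 * a)) by clear -aa a8; lia.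
have {}X : b * (4 * (a.+1 * (2 * a).+1)) < b * (3 * (2 * a * (2 * a))).
  by rewrite ltn_pmul2l.
have {}h3 := leq_mul h3 (leqnn (a.+1 * (2 * a).+1)).
by clear -h3 X; lia.
Qed.

(** The star case deletes two vertices, so the induction also carries [Q] at n - 1. The factor 4/3
    is there for n - 1 = 7: K_7 has 5040 orientations, more than 2^12. *)
Lemma turan_bound_all n S : 7 < n -> #|S| = n -> turan_bound S.
Proof.
move=> n7; pose Q m := forall R : {set T}, #|R| = m -> 3 * num_trans R <= 4 * 2 ^ turan #|R|.
suff [] : (forall R : {set T}, #|R| = n -> turan_bound R) /\ Q n.-1 by move=> H _; exact: H.
rewrite -(subnKC n7); elim: (n - 8) => [|m [IH IQ]] {n n7 S}.
  split=> [R|R cR]; first exact: num_trans_card8.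
  apply: leq_trans (leq_mul (leqnn 3) (num_trans_card7 cR)) _.
  by rewrite cR; vm_compute.
have Qn : Q (8 + m).
  by move=> R cR; apply: leq_mul (turan_bound_le (IH R cR)).
split=> [R cR|]; last by rewrite addnS.
have [v vR md] : exists2 v, v \in R & mindeg #|nbh R v| R.
  by apply: exists_mindeg; rewrite cR.
have cD : #|R :\ v| = 8 + m by have := cardsD1E vR; lia.
have bD := IH _ cD.
have stp : num_stable (nbh R v) <= 2 ^ #|R|./2 -> turan_bound R.
  by move=> st; apply: turan_bound_step vR _ (erefl _) md st bD; lia.
case: (boolP (odd #|R|)) => od; last first.
  by apply: stp; apply: num_stable_even_step => //; have := odd_double_half #|R|; lia.
have cR' : #|R| = (#|R|./2).*2.+1 by have := odd_double_half #|R|; lia.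
case: (num_stable_odd_step cR' _ vR md) => [||[d1 [u uN st]]]; first lia.
  exact: stp.
left; rewrite d1 in md; apply: (num_trans_star cR' _ vR md d1 uN st); first lia.
by move=> R' cR1; apply: IQ; rewrite cR1; lia.
Qed.

End TriangleFree.

(** * Transfer to [num_orient], [max_orient] and graph isomorphism *)

Lemma adj_sym (T : finType) (G : sgraph T) : symmetric (adj G).
Proof.
have /andP[_ /forallP sG] := adj_setP G => x y.
by apply/idP/idP => xy; apply: (implyP (forallP (sG _) _)).
Qed.

Lemma adj_irr (T : finType) (G : sgraph T) : irreflexive (adj G).
Proof. by have /andP[/forallP iG _] := adj_setP G => x; apply/negbTE; exact: iG. Qed.

(** Without loops, the three vertices of a closed directed walk of length 3 are distinct, so
    injectivity is automatic. *)
Lemma contains_C3P (T : finType) (A : digraph T) : (forall x, (x, x) \notin A) ->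
  reflect (exists x y z, [&& (x, y) \in A, (y, z) \in A & (z, x) \in A])
          (contains_copy A C3).
Proof.
move=> irrA; apply: (iffP existsP) => [[f /andP[_ /forallP fA]]|].
  have arc i : (f i, f (ordS i)) \in A.
    by apply: (implyP (forallP (fA i) (ordS i))); rewrite inE.
  exists (f ord0), (f (ordS ord0)), (f (ordS (ordS ord0))); rewrite !arc /=.
  by have := arc (ordS (ordS ord0)); congr ((_, f _) \in A); apply/val_inj.
case=> x [y [z /and3P[xy yz zx]]].
have neq u v : (u, v) \in A -> u != v by apply: contraTneq => ->.
(* The default [x] of [nth] is never reached, as i < 3. *)
exists [ffun i : 'I_3 => nth x [:: x; y; z] i]; apply/andP; split.
  apply/injectiveP => i j; rewrite !ffunE => /eqP.
  rewrite nth_uniq //= => [/eqP/val_inj//|].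
  by rewrite !inE negb_or (neq _ _ xy) (neq _ _ yz) eq_sym (neq _ _ zx).
apply/forallP => i; apply/forallP => j; apply/implyP; rewrite inE /= => /eqP->.
by rewrite !ffunE; case: i => [[|[|[|]]]].
Qed.

Lemma num_orient_C3 (T : finType) (G : sgraph T) :
  num_orient G C3 = num_trans (adj G) [set: T].
Proof.
apply: eq_card => A; rewrite !inE.
have -> : is_orientation G A = [forall x, forall y,
    if [&& x \in [set: T], y \in [set: T] & adj G x y]
    then ((x, y) \in A) (+) ((y, x) \in A) else (x, y) \notin A].
  by apply: eq_forallb => x; apply: eq_forallb => y; rewrite !inE.
apply: andb_id2l => /forallP oA.
have irrA x : (x, x) \notin A.
  by have := forallP (oA x) x; rewrite adj_irr !andbF.
apply/idP/idP => [/(contains_C3P irrA) noC|/forallP noC].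
  apply/forallP => x; apply/forallP => y; apply/forallP => z.
  by apply/negP => C; apply: noC; exists x, y, z.
apply/(contains_C3P irrA) => -[x [y [z]]]; apply/negP.
exact: (forallP (forallP (noC x) y) z).
Qed.

Lemma turanE n : n ^ 2 %/ 4 = turan n.
Proof.
rewrite /turan uphalf_half -{1}(odd_double_half n); case: (odd n).
  have -> : (true + n./2.*2) ^ 2 = n./2 * (true + n./2) * 4 + 1 by rewrite -mulnn; lia.
  by rewrite divnMDl // addn0.
by have -> : (false + n./2.*2) ^ 2 = n./2 * (false + n./2) * 4; rewrite ?mulnK // -mulnn; lia.
Qed.

Lemma balanced_iso (T : finType) (G : sgraph T) n : #|T| = n ->
  balanced (adj G) [set: T] <-> sgraph_iso G (Kbip n./2 (uphalf n)).
Proof.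
move=> cT; have nE : n./2 + uphalf n = n.
  by rewrite uphalf_half -[RHS]odd_double_half; lia.
have adjK u w : adj (Kbip n./2 (uphalf n)) u w = (is_inl u != is_inl w).
  by rewrite /adj inE.
split=> [[X [_ eX] cX]|[f [g fK gK] adjf]].
  rewrite cardsT cT in cX.
  have cY : uphalf n = #|~: X| by have := cardsC X; rewrite cT; lia.
  (* [g] enumerates [X] on the left and its complement on the right; its inverse is the
     isomorphism. *)
  pose g (u : 'I_n./2 + 'I_(uphalf n)) : T :=
    match u with
    | inl i => enum_val (cast_ord (esym cX) i)
    | inr j => enum_val (cast_ord cY j)
    end.
  have gX u : (g u \in X) = is_inl u.
    case: u => i /=; first exact: enum_valP.
    by apply/negbTE; have := enum_valP (cast_ord cY i); rewrite inE.
  have injg : injective g.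
    move=> u w eq_g; have := gX u; rewrite eq_g gX.
    case: u w eq_g => [i|i] [j|j] //= /enum_val_inj /cast_ord_inj -> //.
  have [|f gK fK] := inj_card_bij injg; first by rewrite card_sum !card_ord cT nE.
  exists f; first by exists g.
  by move=> x y; rewrite adjK -!gX !fK eX ?inE.
exists [set x | is_inl (f x)].
  by split=> [|x y _ _]; rewrite ?subsetT // !inE -adjK adjf.
rewrite cardsT cT -[RHS]card_ord -cardsT.
rewrite -(card_imset _ (inj_comp (can_inj gK) (@inl_inj _ 'I_(uphalf n)))).
apply: eq_card => x; rewrite inE; apply/idP/imsetP => [|[i _ ->]].
  by case E: (f x) => [i|//] _; exists i; rewrite //= -E fK.
by rewrite /= gK.
Qed.

(** Provides the lower bound on [max_orient], whose maximum ranges over graphs on ['I_n]. *)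
Lemma exists_balanced n : exists G : sgraph 'I_n, balanced (adj G) [set: 'I_n].
Proof.
pose X := [set x in take n./2 (enum 'I_n)].
have sG : simple_adj [set u : 'I_n * 'I_n | (u.1 \in X) != (u.2 \in X)].
  apply/andP; split; first by apply/forallP => x; rewrite inE eqxx.
  by apply/forallP => x; apply/forallP => y; rewrite !inE eq_sym implybb.
exists (SGraph sG), X.
  by split=> [|x y _ _]; rewrite ?subsetT // /adj !inE.
rewrite cardsE cardsT card_ord (card_uniqP _) ?take_uniq ?enum_uniq //.
rewrite size_takel // size_enum_ord; lia.
Qed.

Theorem theorem1p2 (n : nat) (hn : 8 <= n) :
  max_orient n C3 = 2 ^ (n ^ 2 %/ 4) /\
  (forall (T : finType) (G : sgraph T), #|T| = n ->
     num_orient G C3 = 2 ^ (n ^ 2 %/ 4) <->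
     sgraph_iso G (Kbip n./2 (uphalf n))).
Proof.
rewrite turanE.
have bound (T : finType) (G : sgraph T) : #|T| = n ->
    turan_bound (adj G) [set: T].
  by move=> cT; apply: (turan_bound_all (adj_sym G) (adj_irr G) hn); rewrite cardsT.
have eq_bal (T : finType) (G : sgraph T) : #|T| = n -> balanced (adj G) [set: T] ->
    num_orient G C3 = 2 ^ turan n.
  move=> cT /num_trans_balanced.
  by rewrite num_orient_C3 cardsT cT.
split=> [|T G cT].
  apply/eqP; rewrite eqn_leq; apply/andP; split.
    apply/bigmax_leqP => G _; rewrite num_orient_C3.
    have := turan_bound_le (bound _ G (card_ord n)).
    by rewrite cardsT card_ord.
  have [G bG] := exists_balanced n; rewrite -(eq_bal _ G (card_ord n) bG).
  exact: (leq_bigmax (F := fun G : sgraph 'I_n => num_orient G C3)).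
rewrite -balanced_iso //; split; last exact: eq_bal.
by case: (bound T G cT) => // + eqG; rewrite -num_orient_C3 eqG cardsT cT ltnn.
Qed.
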